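(* For every natural number $N>3$, let $\beta(N)=d_{L(N)}\dots d_{R(N)}$ be the Bergman expansion of $N$. Then $$\mathrm{Tot}^{\nu}(N)=\mathrm{Tot}^{\mathrm{FIB}}\bigl(F_{-R(N)+2}\,N\bigr).$$
   Context: $(F_n)_{n\ge0}=0,1,1,2,3,5,\dots$ are the Fibonacci numbers. $\mathrm{Tot}^{\mathrm{FIB}}(M)$ is the number of Fibonacci expansions of $M$, i.e. the number of finitely supported sequences $(c_i)_{i\ge2}$ with $c_i\in\{0,1\}$ and $M=\sum_{i\ge2}c_iF_i$. Let $\varphi=(1+\sqrt5)/2$. A finite base phi expansion of $N$ is a sequence $(a_i)_{i\in\mathbb Z}$ with $a_i\in\{0,1\}$, only finitely many $a_i$ nonzero, and $N=\sum_i a_i\varphi^i$. The Bergman expansion $\beta(N)$ is the unique finite base phi expansion $(d_i)$ of $N$ in which $d_{i+1}d_i=11$ never occurs; $L(N)$ and $R(N)$ denote the largest and the smallest index $i$ with $d_i=1$. A Knott expansion of $N$ is a finite base phi expansion $(a_i)$ of $N$ such that, if $R$ denotes the smallest index with $a_R=1$, then $a_{R+2}a_{R+1}a_R\neq 011$. A natural base phi expansion of $N$ is a Knott expansion of $N$ whose negative part (the digits to the right of the radix point, up to the last nonzero digit) has the same length as the negative part of $\beta(N)$; i.e. its smallest index with digit $1$ equals $R(N)$. The number of natural base phi expansions of $N$ is denoted $\mathrm{Tot}^{\nu}(N)$. *)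

(* Defs.v *)
From mathcomp Require Import all_boot all_order all_algebra finmap.
From mathcomp Require Import boolp classical_sets cardinality reals.

Set Implicit Arguments.
Unset Strict Implicit.
Unset Printing Implicit Defensive.

Import Order.TTheory GRing.Theory Num.Theory.

Local Open Scope ring_scope.

(* The values are F_n and F_(n+1). *)
Fixpoint fib_pair (n : nat) : nat * nat :=
  if n is m.+1 then let: (x, y) := fib_pair m in (y, (x + y)%N) else (0%N, 1%N).

Definition fib (n : nat) : nat := (fib_pair n).1.

Lemma fib0 : fib 0 = 0%N. Proof. by []. Qed.

Lemma fib1 : fib 1 = 1%N. Proof. by []. Qed.

Lemma fibSS (n : nat) : fib n.+2 = (fib n.+1 + fib n)%N.
Proof. by rewrite /fib /=; case: (fib_pair n) => x y /=; rewrite addnC. Qed.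

(* The number of elements of a finite set; [fset_set] sends infinite sets to
   the empty set, but it is only used below on sets that are finite. *)
Definition count_set (T : choiceType) (A : set T) : nat := #|` fset_set A|.

(* A sequence (c_i)_(i >= 2) is extended by 0 at the indices 0 and 1. *)
Definition fib_expansion (M : nat) (c : {fsfun nat -> bool with false}) : Prop :=
  (forall i, c i -> (2 <= i)%N) /\
  M = (\sum_(i <- finsupp c) c i * fib i)%N.

Definition TotFIB (M : nat) : nat := count_set [set c | fib_expansion M c]%classic.

Definition phi (R : realType) : R := (1 + Num.sqrt 5) / 2.

(* Finitely supported two-sided sequences of binary digits. *)
Definition digits := {fsfun int -> bool with false}.

Definition phi_expansion (R : realType) (N : nat) (a : digits) : Prop :=
  N%:R = \sum_(i <- finsupp a) (a i)%:R * phi R ^ i.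

Definition smallest_index (a : digits) (r : int) : Prop :=
  a r /\ forall i, a i -> r <= i.

Definition bergman_expansion (R : realType) (N : nat) (d : digits) : Prop :=
  phi_expansion R N d /\ forall i : int, ~~ (d (i + 1) && d i).

(* Every natural number has exactly one Bergman expansion, so the default value
   of [xget] is irrelevant here. *)
Definition beta (R : realType) (N : nat) : digits :=
  xget [fsfun]%fsfun [set d | bergman_expansion R N d]%classic.

(* R(N), for N > 0. *)
Definition Rindex (R : realType) (N : nat) : int :=
  xget 0 [set r | smallest_index (beta R N) r]%classic.

Definition knott_expansion (R : realType) (N : nat) (a : digits) : Prop :=
  phi_expansion R N a /\
  forall r, smallest_index a r -> ~~ [&& ~~ a (r + 2), a (r + 1) & a r].

Definition natural_expansion (R : realType) (N : nat) (a : digits) : Prop :=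
  knott_expansion R N a /\ smallest_index a (Rindex R N).

Definition Totnu (R : realType) (N : nat) : nat :=
  count_set [set a | natural_expansion R N a]%classic.

(* Main.v *)
Require Import Defs.
From mathcomp Require Import all_boot all_order all_algebra finmap.
From mathcomp Require Import boolp classical_sets cardinality reals.
From mathcomp Require Import zify ring lra.

Set Implicit Arguments.
Unset Strict Implicit.
Unset Printing Implicit Defensive.

Import Order.TTheory GRing.Theory Num.Theory.

Local Open Scope ring_scope.

(** A natural expansion [a] of [N], read from its last position [r = R(N)], is a
word [b_j = a_(r+j)].  Multiplying [N = \sum_i a_i phi^i] by [phi^(2-r)] gives
  [phi^2 * \sum_j b_j phi^j = N * phi^k] with [k = 2 - r].
Since [phi^i = F_i phi + F_(i-1)] and [phi] is irrational, this one equation says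
that [\sum_j b_j F_(j+2) = N F_k] and [\sum_j b_j F_(j+1) = N F_(k-1)].  The
first equation makes [b] a Fibonacci expansion of [F_k N].  The bijection of the
theorem is thus the shift of digits that sends position [r] to position 2, and
what has to be shown is that every Fibonacci expansion of [F_k N] arises from a
natural expansion.

The key is the conjugate [psi = 1 - phi].  For a binary word, [\sum_j b_j psi^j]
lies strictly between [-1] and [phi] ([eval_psi_bounds]).  Multiplied by [psi^2]
it equals [A psi + B] with [A = \sum_j b_j F_(j+2)] and [B = \sum_j b_j F_(j+1)],
and it lies in an open interval of length [psi^2 - psi = 1].  So the integer [A]
determines the integer [B] ([companion_unique]), and hence determines the values
of the word at [phi] and at [psi] ([eval_eq_fsum]).  This gives the second
equation: a Fibonacci expansion of [F_k N] takes the same values as the shifted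
Bergman expansion, so it is a base phi expansion of [N] after shifting back.

It remains to see that its last digits are as required.  The value at [psi] also
decides this.  It exceeds [-psi] when the word starts with 1, 0
([lead_digits_lt]), as the shifted Bergman expansion does, while a word starting
with 0 or with 1, 1, 0 has a value below [-psi] ([lt_lead_digits]).

The existence of a Bergman expansion comes from the same argument: the Zeckendorf
expansion of [N F_k], for an even [k] so large that [N psi^k] is small, is a base
phi expansion of [N phi^k] ([bergman_window]). *)

(** * The golden ratio, its conjugate and Fibonacci numbers *)

Definition psi (R : realType) : R := 1 - phi R.

Lemma phi_gt (R : realType) : 3 / 2 < phi R.
Proof.
rewrite /phi ltr_pM2r ?invr_gt0 //.
have : Num.sqrt 4 < Num.sqrt 5 :> R by rewrite ltr_sqrt //; lra.
have -> : 4 = 2 ^+ 2 :> R by rewrite expr2; lra.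
by rewrite sqrtr_sqr ger0_norm //; lra.
Qed.

Lemma phi_sq (R : realType) : phi R ^+ 2 = phi R + 1.
Proof.
have h : Num.sqrt 5 ^+ 2 = 5 :> R by rewrite sqr_sqrtr //.
rewrite /phi; set s := Num.sqrt 5 in h *.
have -> : ((1 + s) / 2) ^+ 2 = (1 + 2 * s + s ^+ 2) / 4 by field.
by rewrite h; field.
Qed.

Lemma psi_sq (R : realType) : psi R ^+ 2 = psi R + 1.
Proof.
have h := phi_sq R; rewrite /psi.
have -> : (1 - phi R) ^+ 2 = 1 - 2 * phi R + phi R ^+ 2 by ring.
by rewrite h; ring.
Qed.

Lemma psi_phi (R : realType) : psi R * phi R = -1.
Proof.
have h := phi_sq R; rewrite /psi.
have -> : (1 - phi R) * phi R = phi R - phi R ^+ 2 by ring.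
by rewrite h; ring.
Qed.

Lemma psi_lt0 (R : realType) : psi R < 0.
Proof. by have := phi_gt R; rewrite /psi; lra. Qed.

Lemma psi_sq_gt0 (R : realType) : 0 < psi R ^+ 2.
Proof. by rewrite exprn_even_gt0 //= lt_eqF ?psi_lt0. Qed.

Lemma psi_sq_phi (R : realType) : psi R ^+ 2 * phi R = - psi R.
Proof. by rewrite expr2 -mulrA psi_phi mulrN1. Qed.

Lemma expr_fib (R : realType) (x : R) (n : nat) :
  x ^+ 2 = x + 1 -> x ^+ n.+1 = (fib n.+1)%:R * x + (fib n)%:R.
Proof.
move=> hx; elim: n => [|n IH]; first by rewrite expr1 fib1 fib0 mul1r addr0.
rewrite exprS IH mulrDr fibSS natrD.
have -> : x * ((fib n.+1)%:R * x) = (fib n.+1)%:R * x ^+ 2 by ring.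
by rewrite hx; ring.
Qed.

Lemma fib_gt0 (n : nat) : (0 < fib n.+1)%N.
Proof. by elim: n => // n IH; rewrite fibSS addn_gt0 IH. Qed.

(** If [u phi = v] then [(2v - u)^2 = 5 u^2], and the exponent of 5 is even on
the left and odd on the right unless [u] vanishes. *)
Lemma phi_irrational (R : realType) (u v : int) :
  u%:~R * phi R = v%:~R -> u = 0.
Proof.
move=> h.
have hq : (2 * v - u) ^+ 2 = 5 * u ^+ 2.
  apply: (@intr_inj R) => /=.
  rewrite !expr2 !(intrM, intrB) -h -!expr2.
  have -> : (2%:~R * (u%:~R * phi R) - u%:~R) ^+ 2
    = u%:~R ^+ 2 * (4 * phi R ^+ 2 - 4 * phi R + 1) :> R by ring.
  by rewrite phi_sq; ring.
have {}hq : (absz (2 * v - u)%R ^ 2 = 5 * absz u ^ 2)%N.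
  by rewrite -!abszX hq abszM.
apply/eqP; rewrite -absz_eq0; case: posnP => // u0.
have w0 : (0 < absz (2 * v - u)%R)%N.
  by rewrite -(ltn_exp2r 0 _ (isT : 0 < 2)%N) hq exp0n // muln_gt0 expn_gt0 u0.
have := congr1 (logn 5) hq; rewrite lognM ?expn_gt0 ?u0 // !lognX.
by rewrite (logn_prime 5 (isT : prime 5)) /=; lia.
Qed.

Lemma phi_coordinates (R : realType) (a b a' b' : nat) :
  a%:R * phi R + b%:R = a'%:R * phi R + b'%:R -> a = a' /\ b = b'.
Proof.
move=> h; have /eqP : a%:Z - a'%:Z = 0.
  apply: (@phi_irrational R _ (b'%:Z - b%:Z)).
  by rewrite !intrB /= -!pmulrn mulrBl; lra.
rewrite subr_eq0 => /eqP [] ha; split=> //.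
by move: h; rewrite ha => /addrI /eqP; rewrite eqr_nat => /eqP.
Qed.

(** * Binary words and their values at phi and psi *)

Definition eval (R : realType) (x : R) (n : nat) (b : nat -> bool) : R :=
  \sum_(j < n) (b j)%:R * x ^+ j.

(** The value of the word in the Fibonacci system when its first digit has weight
[fib m]; the offsets 2 and 1 give the two coordinates of [phi^2 * eval phi]. *)
Definition fsum (m n : nat) (b : nat -> bool) : nat :=
  (\sum_(j < n) b j * fib (m + j))%N.

Lemma eval_fsum (R : realType) (x : R) (m n : nat) (b : nat -> bool) :
  x ^+ 2 = x + 1 ->
  x ^+ m.+1 * eval x n b = (fsum m.+1 n b)%:R * x + (fsum m n b)%:R.
Proof.
move=> hx; rewrite /eval /fsum !natr_sum mulr_sumr mulr_suml -big_split /=.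
apply: eq_bigr => j _; rewrite mulrCA -exprD addSn expr_fib // !natrM; ring.
Qed.

Lemma evalS (R : realType) (x : R) (n : nat) (b : nat -> bool) :
  eval x n.+1 b = (b 0%N)%:R + x * eval x n (fun j => b j.+1).
Proof.
rewrite /eval big_ord_recl expr0 mulr1 mulr_sumr; congr (_ + _).
by apply: eq_bigr => j _; rewrite lift0 exprS mulrCA.
Qed.

(** The interval is mapped into itself by [t |-> c + psi t] for both digits [c]:
since [psi phi = -1], multiplication by [psi] takes it to the interval from [-1]
to [- psi = phi - 1]. *)
Lemma eval_psi_bounds (R : realType) (n : nat) (b : nat -> bool) :
  -1 < eval (psi R) n b < phi R.
Proof.
have := phi_gt R => hp.
elim: n b => [|n IH] b; first by rewrite /eval big_ord0; apply/andP; split; lra.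
have /andP [h1 h2] := IH (fun j => b j.+1).
rewrite evalS; move: h1 h2.
rewrite -(ltr_nM2l (psi_lt0 R)) => h1.
rewrite -(ltr_nM2l (psi_lt0 R)) psi_phi => h2.
move: h1 h2; rewrite /psi; set X := _ * eval _ _ _.
by case: (b 0%N) => /= h1 h2; apply/andP; split; lra.
Qed.

(** Both [fsum 2 n b * psi + fsum 1 n b = psi^2 * eval psi n b] and the number
with [B] in place of [fsum 1 n b] lie in an open interval of length 1. *)
Lemma companion_unique (R : realType) (n B : nat) (b : nat -> bool) :
  - psi R ^+ 2 < (fsum 2 n b)%:R * psi R + B%:R < - psi R ->
  fsum 1 n b = B.
Proof.
have /andP [] := eval_psi_bounds R n b.
have p0 := psi_sq_gt0 R.
rewrite -(ltr_pM2l p0) => h1; rewrite -(ltr_pM2l p0) => h2.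
move: h1 h2; rewrite (eval_fsum 1 n b (psi_sq R)).
rewrite psi_sq_phi mulrN1 psi_sq => h1 h2 /andP [h3 h4].
apply/eqP; rewrite eqn_leq -(ltnS (fsum 1 n b)) -(ltnS B) -!(ltr_nat R) -!natr1.
by apply/andP; split; lra.
Qed.

Lemma fsum_companion (R : realType) (n n' : nat) (b b' : nat -> bool) :
  fsum 2 n b = fsum 2 n' b' -> fsum 1 n b = fsum 1 n' b'.
Proof.
move=> h; apply: (@companion_unique R).
rewrite h -(eval_fsum 1 n' b' (psi_sq R)).
have /andP [h1 h2] := eval_psi_bounds R n' b'.
have p0 := psi_sq_gt0 R.
by rewrite -psi_sq_phi -mulrN1 !ltr_pM2l // h1.
Qed.

Lemma eval_eq_fsum (R : realType) (x : R) (n n' : nat) (b b' : nat -> bool) :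
  x ^+ 2 = x + 1 -> fsum 2 n b = fsum 2 n' b' -> eval x n b = eval x n' b'.
Proof.
move=> hx h.
have x0 : x ^+ 2 != 0.
  apply/eqP => h0; move: (h0) hx => /eqP.
  by rewrite sqrf_eq0 => /eqP ->; rewrite expr0n /= add0r => /esym/eqP; rewrite oner_eq0.
apply: (mulfI x0).
by rewrite !(eval_fsum 1) // h (fsum_companion R h).
Qed.

(** The remaining digits contribute more than [- psi^2], and [1 - psi^2 = - psi].
Three digits are reserved only to match [lt_lead_digits]. *)
Lemma lead_digits_lt (R : realType) (n : nat) (b : nat -> bool) :
  b 0%N -> ~~ b 1%N -> - psi R < eval (psi R) n.+3 b.
Proof.
move=> b0 b1; rewrite evalS evalS b0 (negbTE b1) /= add0r mulrA -expr2.
have /andP [h1 _] := eval_psi_bounds R n.+1 (fun j => b j.+2).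
have p0 := psi_sq_gt0 R.
move: h1; rewrite -(ltr_pM2l p0) mulrN1; have := psi_sq R; lra.
Qed.

(** After a leading 0 the value is [psi t] with [t > -1], hence below [- psi].
After 1, 1, 0 it is [1 + psi + psi^3 t], and [1 + psi - psi^3 = - psi]. *)
Lemma lt_lead_digits (R : realType) (n : nat) (b : nat -> bool) :
  - psi R < eval (psi R) n.+3 b -> b 0%N && ~~ [&& ~~ b 2%N, b 1%N & b 0%N].
Proof.
have p0 := psi_lt0 R; have q := psi_sq R.
rewrite evalS; case b0: (b 0%N) => /=; last first.
  have /andP [h1 _] := eval_psi_bounds R n.+2 (fun j => b j.+1).
  by move: h1; rewrite -(ltr_nM2l p0) mulrN1 add0r; lra.
rewrite evalS evalS; case b1: (b 1%N); case: (b 2%N) => //=.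
have /andP [h1 _] := eval_psi_bounds R n (fun j => b j.+3).
have p3 : psi R ^+ 3 < 0 by rewrite exprn_odd_lt0.
move: h1; rewrite -(ltr_nM2l p3) mulrN1 add0r mulrDr mulr1 !mulrA -expr2 -exprSr.
by rewrite exprS q mulrDr mulr1 -expr2 q; lra.
Qed.

(** * Zeckendorf and Bergman expansions *)

(** The greedy choice: once [fib m.+3] is taken, the remainder is below
[fib m.+2], so its expansion leaves the neighbouring position empty.  The
induction carries two consecutive lengths for this reason. *)
Lemma zeckendorf (n M : nat) :
  (M < fib n.+2)%N ->
  exists b : nat -> bool,
    [/\ forall j, b j -> (j < n)%N, forall j, ~~ (b j.+1 && b j)
      & fsum 2 n b = M].
Proof.
pose Z m K := exists b : nat -> bool,
  [/\ forall j, b j -> (j < m)%N, forall j, ~~ (b j.+1 && b j) & fsum 2 m b = K].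
suff H m : (forall K, (K < fib m.+2)%N -> Z m K) /\
           (forall K, (K < fib m.+3)%N -> Z m.+1 K) by case: (H n) => + _; apply.
have ext k (b : nat -> bool) :
    (forall j, b j -> (j < k)%N) -> fsum 2 k.+1 b = fsum 2 k b.
  move=> hb; rewrite /fsum big_ord_recr /= -[RHS]addn0; congr addn.
  by case: (b k) (hb k) => // /(_ isT); rewrite ltnn.
have widen k K : Z k K -> Z k.+1 K.
  case=> b [h1 h2 h3]; exists b; split=> //; last by rewrite ext.
  by move=> j /h1 /ltnW.
have zero : Z 0%N 0%N by exists xpred0; split=> //; rewrite /fsum big_ord0.
elim: m => [|m [IH1 IH2]]; split=> // K.
- by case: K => // _; exact: zero.
- case: K => [|[|//]] _; first exact: widen.
  exists (pred1 0%N); split=> [j /eqP -> //|[|j] //|].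
  by rewrite /fsum big_ord_recl big_ord0.
case: (ltnP K (fib m.+3)) => [/IH2/widen //|hK hK'].
have [|b [h1 h2 h3]] := IH1 (K - fib m.+3)%N.
  by rewrite ltn_subLR // -fibSS.
exists (fun j => (j == m.+1) || b j); split=> [j /orP [/eqP -> //|/h1]|j|].
- by lia.
- apply/negP => /andP [/orP [/eqP [->]|hb]] /orP [/eqP hj|hb'].
  + by lia.
  + by have := h1 _ hb'; rewrite ltnn.
  + by have := h1 _ hb; lia.
  + by have := h2 j; rewrite hb hb'.
rewrite /fsum big_ord_recr /= eqxx mul1n.
rewrite (eq_bigr (fun j : 'I_m.+1 => b j * fib (2 + j))%N); last first.
  by move=> j _; rewrite ltn_eqF.
by rewrite -/(fsum 2 m.+1 b) ext // h3 subnK.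
Qed.

Lemma expr_small (R : realType) (x : R) (n : nat) :
  0 <= x -> x <= 1 / 2 -> n%:R * x ^+ n <= 1.
Proof.
move=> x0 x1; elim: n => [|n IH]; first by rewrite mul0r.
have h : x ^+ n <= 1 by rewrite exprn_ile1 //; lra.
have h0 : 0 <= x ^+ n by rewrite exprn_ge0.
rewrite -natr1 exprSr mulrA mulrDl mul1r.
apply: (@le_trans _ _ (2 * x)); last by lra.
by rewrite ler_wpM2r //; lra.
Qed.

Lemma fsum_of_eval (R : realType) (n N k : nat) (b : nat -> bool) :
  phi R ^+ 2 * eval (phi R) n b = N%:R * phi R ^+ k.+1 ->
  fsum 2 n b = (N * fib k.+1)%N.
Proof.
rewrite (eval_fsum 1 n b (phi_sq R)) (expr_fib k (phi_sq R)) mulrDr mulrA -!natrM.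
by case/phi_coordinates.
Qed.

(** The Zeckendorf word of [N * fib k.+1] has value [N phi^(k+1)] as soon as its
other coordinate is [N * fib k].  By [companion_unique] this holds when
[N psi^(k+1)] is in the interval considered there; the exponent [2 * N + 2] is
even, which makes the number nonnegative, and large enough to make it at most
[psi^2 < - psi]. *)
Lemma bergman_window (R : realType) (N : nat) :
  exists k n (b : nat -> bool),
    [/\ forall j, b j -> (j < n)%N, forall j, ~~ (b j.+1 && b j)
      & phi R ^+ 2 * eval (phi R) n b = N%:R * phi R ^+ k].
Proof.
pose k := (2 * N + 1)%N; pose M := (N * fib k.+1)%N.
have le_fib n : (n <= fib n.+2)%N.
  elim: n => // n IH; rewrite fibSS.
  by have := fib_gt0 n; lia.
have [|b [h1 h2 h3]] := @zeckendorf M.+1 M; first exact: le_fib.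
exists k.+1, M.+1, b; split=> //.
rewrite (eval_fsum 1 _ b (phi_sq R)) (expr_fib k (phi_sq R)) mulrDr mulrA -!natrM.
rewrite h3 (@companion_unique R M.+1 (N * fib k)) // h3 !natrM -mulrA -mulrDr.
rewrite -(expr_fib k (psi_sq R)).
have p0 := psi_lt0 R; have q := psi_sq R; have hp := phi_gt R.
have -> : psi R ^+ k.+1 = (psi R ^+ 2) ^+ N * psi R ^+ 2.
  by rewrite -exprM -exprD; congr (_ ^+ _); rewrite /k; lia.
have q0 := psi_sq_gt0 R.
have q1 : psi R ^+ 2 < 1 / 2 by rewrite q /psi; lra.
have e := @expr_small R (psi R ^+ 2) N (ltW q0) (ltW q1).
have e0 : 0 <= N%:R * (psi R ^+ 2) ^+ N by rewrite mulr_ge0 // exprn_ge0 // ltW.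
rewrite mulrA; apply/andP; split.
  by apply: (@lt_le_trans _ _ 0); [lra | rewrite mulr_ge0 // ltW].
apply: (@le_lt_trans _ _ (psi R ^+ 2)); last by rewrite q /psi; lra.
by rewrite ger_pMl.
Qed.

(** * Finitely supported digit sequences *)

(** Finiteness need not be known: if one set is infinite, so is the other, and
both counts are 0. *)
Lemma count_set_bij (T U : choiceType) (A : set T) (B : set U)
    (f : T -> U) (g : U -> T) :
  (forall a, A a -> B (f a)) -> (forall b, B b -> A (g b)) ->
  (forall a, A a -> g (f a) = a) -> (forall b, B b -> f (g b) = b) ->
  count_set A = count_set B.
Proof.
move=> fAB gBA gf fg.
have -> : B = (f @` A)%classic.
  by apply/seteqP; split=> [b Bb|_ [a Aa <-]]; [exists (g b); auto | exact: fAB].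
have card_fA : (f @` A #= A)%card.
  apply: inj_card_eq => a a' /set_mem Aa /set_mem Aa' faa'.
  by rewrite -(gf _ Aa) faa' gf.
have fin := eq_finite_set card_fA.
rewrite /count_set; have [finA|infA] := pselect (finite_set A).
  by apply/esym/fcard_eq => //; rewrite fin.
have infB : ~ finite_set (f @` A)%classic by rewrite fin.
by rewrite /fset_set; case: pselect => // _; case: pselect.
Qed.

Lemma fsfun_bound (K : choiceType) (a : {fsfun K -> bool with false})
    (g : K -> nat) : exists n, forall i, a i -> (g i < n)%N.
Proof.
exists (\max_(i <- finsupp a) g i).+1 => i ai; rewrite ltnS.
by apply: leq_bigmax_seq; rewrite ?mem_finsupp ?ai.
Qed.

(** A finitely supported sequence with values [e]; the list [s] only has to
contain the support of [e]. *)
Definition table (K : choiceType) (s : seq K) (e : K -> bool) :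
  {fsfun K -> bool with false} := [fsfun x in seq_fset tt s => e x].

Lemma tableE (K : choiceType) (s : seq K) (e : K -> bool) :
  (forall x, e x -> x \in s) -> table s e =1 e.
Proof.
move=> h x; rewrite /table fsfunE seq_fsetE.
by case: ifP => // /negP xs; case e_x: (e x) => //; case: xs; apply: h.
Qed.

Lemma big_finsupp (T : Type) (idx : T) (op : Monoid.com_law idx)
    (K : choiceType) (a : {fsfun K -> bool with false}) (s : seq K) (G : K -> T) :
  uniq s -> (forall i, a i -> i \in s) -> (forall i, ~~ a i -> G i = idx) ->
  \big[op/idx]_(i <- finsupp a) G i = \big[op/idx]_(i <- s) G i.
Proof.
move=> us has0 hG; rewrite [RHS](bigID a) /= [X in op _ X]big1 // Monoid.mulm1.
rewrite -[RHS]big_filter; apply: perm_big; apply: uniq_perm; rewrite ?filter_uniq //.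
move=> i; rewrite mem_filter mem_finsupp; case ai: (a i) => //=.
by rewrite has0.
Qed.

Lemma digits_eval (R : realType) (a : digits) (r : int) (n : nat) :
  (forall i, a i -> r <= i /\ (absz (i - r)%R < n)%N) ->
  \sum_(i <- finsupp a) (a i)%:R * phi R ^ i
    = phi R ^ r * eval (phi R) n (fun j => a (r + j%:Z)).
Proof.
move=> ha; rewrite (@big_finsupp _ _ _ _ a [seq r + j%:Z | j <- iota 0 n]).
- rewrite big_map /eval mulr_sumr -[n in iota 0 n]subn0 -/(index_iota 0 n).
  rewrite big_mkord; apply: eq_bigr => j _; rewrite expfzDr // 1?mulrCA //.
  by apply/eqP => p0; have := phi_gt R; rewrite p0; lra.
- by rewrite map_inj_uniq ?iota_uniq // => i j /addrI [].
- move=> i /ha [h1 h2]; apply/mapP; exists (absz (i - r)%R); first by rewrite mem_iota.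
  by lia.
- by move=> i /negbTE ->; rewrite mul0r.
Qed.

Lemma fib_expansion_fsum (c : {fsfun nat -> bool with false}) (n : nat) :
  (forall i, c i -> (2 <= i < n.+2)%N) ->
  (\sum_(i <- finsupp c) c i * fib i)%N = fsum 2 n (fun j => c j.+2).
Proof.
move=> hc; rewrite (@big_finsupp _ _ _ _ c (iota 2 n)) ?iota_uniq //.
- rewrite (iotaDl 2 0) big_map /fsum -[n in iota 0 n]subn0 -/(index_iota 0 n).
  by rewrite big_mkord.
- by move=> i /hc; rewrite mem_iota.
- by move=> i /negbTE ->.
Qed.

(** The equation is cleared of negative powers by the factor [phi^(2-r)], so that
position [r] gets weight [phi^2], as position 2 does among Fibonacci digits. *)
Lemma phi_expansion_window (R : realType) (N : nat) (a : digits) (r : int)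
    (n k : nat) :
  k%:Z = 2 - r -> (forall i, a i -> r <= i /\ (absz (i - r)%R < n)%N) ->
  phi_expansion R N a <->
  phi R ^+ 2 * eval (phi R) n (fun j => a (r + j%:Z)) = N%:R * phi R ^+ k.
Proof.
move=> hk ha; have p0 : phi R != 0.
  by apply/eqP => p0; have := phi_gt R; rewrite p0; lra.
have e : phi R ^+ 2 = phi R ^ r * phi R ^+ k.
  by rewrite !exprnP -expfzDr // hk addrC subrK.
rewrite /phi_expansion (digits_eval R ha) e mulrAC.
split=> [<- //|h]; apply: (mulIf (expf_neq0 k p0)); exact: esym.
Qed.

Lemma bergman_exists (R : realType) (N : nat) :
  exists d, bergman_expansion R N d.
Proof.
have [k [n [b [h1 h2 h3]]]] := bergman_window R N.
pose r : int := 2 - k%:Z.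
pose e i := (r <= i) && b (absz (i - r)%R).
pose d : digits := table [seq r + j%:Z | j <- iota 0 n] e.
have dE : d =1 e.
  apply: tableE => i /andP [ri bi]; apply/mapP; exists (absz (i - r)%R).
    by rewrite mem_iota /= h1.
  by lia.
exists d; split.
  apply/(@phi_expansion_window _ _ _ r n k); first by rewrite /r; lia.
    by move=> i; rewrite dE => /andP [ri /h1].
  rewrite -h3; congr (_ * _); apply: eq_bigr => j _; rewrite dE /e.
  by rewrite lerDl /= addrAC subrr add0r.
move=> i; rewrite !dE /e; apply/negP => /andP [/andP [i1 bi1] /andP [i0 bi0]].
have := h2 (absz (i - r)%R); rewrite bi0 andbT.
have <- : absz (i + 1 - r)%R = (absz (i - r)%R).+1 by lia.
by move/negP; apply.
Qed.

Lemma smallest_index_exists (a : digits) (i0 : int) :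
  a i0 -> exists r, smallest_index a r.
Proof.
move=> ai0; have [n hn] := fsfun_bound a absz.
have ex : exists m, a (m%:Z - n%:Z).
  exists (absz (i0 + n%:Z)%R); have := hn _ ai0 => ?.
  by have -> : (absz (i0 + n%:Z)%R)%:Z - n%:Z = i0 by lia.
case: (ex_minnP ex) => m am hm; exists (m%:Z - n%:Z); split=> // i ai.
have hi := hn _ ai.
have := hm (absz (i + n%:Z)%R).
have -> : (absz (i + n%:Z)%R)%:Z - n%:Z = i by lia.
by move=> /(_ ai); lia.
Qed.

Lemma betaP (R : realType) (N : nat) : bergman_expansion R N (beta R N).
Proof. exact: (xgetPex _ (bergman_exists R N)). Qed.

Lemma RindexP (R : realType) (N : nat) :
  (0 < N)%N -> smallest_index (beta R N) (Rindex R N).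
Proof.
move=> N0; apply: (@xgetPex _ 0 [set r | smallest_index (beta R N) r]%classic).
have [hb _] := betaP R N.
have [[i bi]|no] := pselect (exists i, beta R N i).
  exact: smallest_index_exists bi.
move: hb; rewrite /phi_expansion big1 => [/eqP|i _]; last first.
  by case bi: (beta R N i); [case: no; exists i | rewrite mul0r].
by rewrite pnatr_eq0 => /eqP N1; rewrite N1 in N0.
Qed.

Lemma smallest_window (a : digits) (r : int) :
  (forall i, a i -> r <= i) ->
  exists n, forall i, a i -> r <= i /\ (absz (i - r)%R < n.+3)%N.
Proof.
move=> ha; have [n hn] := fsfun_bound a (fun i => absz (i - r)%R).
by exists n => i ai; split; [exact: ha | have := hn i ai; lia].
Qed.

(** If all positions are positive, then [N = A phi + B] with [A] a sum of
Fibonacci numbers of positive index; irrationality forces [A = 0]. *)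
Lemma smallest_index_le0 (R : realType) (N : nat) (a : digits) (r : int) :
  phi_expansion R N a -> smallest_index a r -> r <= 0.
Proof.
move=> ha [ar hr]; rewrite leNgt; apply/negP => r0.
have [n hn] := smallest_window hr.
have [m rm] : exists m : nat, r = m.+1%:Z by exists (absz r).-1; lia.
move: ha; rewrite /phi_expansion (digits_eval R hn) {1}rm -exprnP.
rewrite (eval_fsum m _ _ (phi_sq R)).
have -> : N%:R = 0%:R * phi R + N%:R :> R by rewrite mul0r add0r.
case/phi_coordinates => /esym + _.
rewrite /fsum big_ord_recl /= addr0 ar addn0.
by have := fib_gt0 m; rewrite mul1n; case: (fib m.+1).
Qed.

(** * The shift between base phi and Fibonacci expansions *)

(** The guard [2 <= j] concerns the positions 0 and 1, which correspond to the
positions [r - 2] and [r - 1] and are not Fibonacci digits. *)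
Definition to_fib (r : int) (a : digits) : {fsfun nat -> bool with false} :=
  table [seq absz (i - r + 2)%R | i <- finsupp a]
        (fun j => (2 <= j)%N && a (r + (j%:Z - 2))).

Definition of_fib (r : int) (c : {fsfun nat -> bool with false}) : digits :=
  table [seq r + (j%:Z - 2) | j <- finsupp c]
        (fun i => (r <= i) && c (absz (i - r + 2)%R)).

Lemma to_fibE (r : int) (a : digits) :
  to_fib r a =1 (fun j => (2 <= j)%N && a (r + (j%:Z - 2))).
Proof.
apply: tableE => j /andP [j2 aj]; apply/mapP; exists (r + (j%:Z - 2)).
  by rewrite mem_finsupp aj.
by lia.
Qed.

Lemma of_fibE (r : int) (c : {fsfun nat -> bool with false}) :
  of_fib r c =1 (fun i => (r <= i) && c (absz (i - r + 2)%R)).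
Proof.
apply: tableE => i /andP [ri ci]; apply/mapP; exists (absz (i - r + 2)%R).
  by rewrite mem_finsupp ci.
by lia.
Qed.

Lemma to_fibK (r : int) (a : digits) :
  (forall i, a i -> r <= i) -> of_fib r (to_fib r a) = a.
Proof.
move=> ha; apply/fsfunP => i; rewrite of_fibE to_fibE.
have [ri|ri] := leP r i; last first.
  by case ai: (a i) => //; have := ha i ai; lia.
have -> : r + ((absz (i - r + 2)%R)%:Z - 2) = i by lia.
by have -> : (2 <= absz (i - r + 2)%R)%N by lia.
Qed.

Lemma of_fibK (r : int) (c : {fsfun nat -> bool with false}) :
  (forall j, c j -> (2 <= j)%N) -> to_fib r (of_fib r c) = c.
Proof.
move=> hc; apply/fsfunP => j; rewrite to_fibE of_fibE.
have [j2|j2] := leqP 2 j; last first.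
  by case cj: (c j) => //; have := hc j cj; lia.
have -> : absz (r + (j%:Z - 2) - r + 2)%R = j by lia.
by have -> : r <= r + (j%:Z - 2) by lia.
Qed.

Lemma to_fib_expansion (R : realType) (N : nat) (a : digits) (r : int) (k : nat) :
  k.+1%:Z = 2 - r -> (forall i, a i -> r <= i) ->
  phi_expansion R N a -> fib_expansion (fib k.+1 * N) (to_fib r a).
Proof.
move=> hk ra ha; have [n hn] := smallest_window ra.
split=> [j|]; first by rewrite to_fibE => /andP [].
rewrite (@fib_expansion_fsum _ n.+3); last first.
  by move=> j; rewrite to_fibE => /andP [j2 /hn [_ jn]]; rewrite j2 /=; lia.
move/(phi_expansion_window R N hk hn)/fsum_of_eval: ha.
rewrite mulnC => <-; apply: eq_bigr => j _; rewrite to_fibE /=.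
by congr (_ * _)%N; congr (nat_of_bool (a _)); lia.
Qed.

(** The shifted [c] and the Bergman word [d] have the same Fibonacci sum, hence
the same values at [phi] and at [psi].  The first makes [of_fib r c] an expansion
of [N]; the second, compared with [- psi], carries the condition on the last
digits over from [d]. *)
Lemma of_fib_natural (R : realType) (N : nat) (d : digits) (r : int) (k : nat)
    (c : {fsfun nat -> bool with false}) :
  k.+1%:Z = 2 - r -> bergman_expansion R N d -> smallest_index d r ->
  fib_expansion (fib k.+1 * N) c ->
  knott_expansion R N (of_fib r c) /\ smallest_index (of_fib r c) r.
Proof.
move=> hk [hd nadj] [dr rd] [c2 hc].
have [n hn] := smallest_window rd.
have ra i : of_fib r c i -> r <= i by rewrite of_fibE => /andP [].
have [m hm] := smallest_window ra.
pose w j := of_fib r c (r + j%:Z); pose wd j := d (r + j%:Z).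
have hd' := (phi_expansion_window R N hk hn).1 hd.
have same : fsum 2 m.+3 w = fsum 2 n.+3 wd.
  rewrite (fsum_of_eval hd') mulnC hc (@fib_expansion_fsum _ m.+3).
    apply: eq_bigr => j _; rewrite /w of_fibE.
    by congr (nat_of_bool _ * _)%N; rewrite lerDl /=; congr (c _); lia.
  move=> j cj; have j2 := c2 j cj; rewrite j2 /=.
  have [|_] := hm (r + (j%:Z - 2)); last by lia.
  rewrite of_fibE; have -> : absz (r + (j%:Z - 2) - r + 2)%R = j by lia.
  by rewrite cj andbT; lia.
have /andP [w0 wK] : w 0%N && ~~ [&& ~~ w 2%N, w 1%N & w 0%N].
  apply: (@lt_lead_digits R m); rewrite (eval_eq_fsum (psi_sq R) same).
  apply: lead_digits_lt; rewrite /wd ?addr0 //.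
  by have := nadj r; rewrite dr andbT.
have small : smallest_index (of_fib r c) r by split=> //; move: w0; rewrite /w addr0.
split=> //; split.
  by apply/(phi_expansion_window R N hk hm); rewrite (eval_eq_fsum (phi_sq R) same).
move=> r' [ar' hr'].
have -> : r' = r by apply/eqP; rewrite eq_le ra // hr' //; case: small.
by move: wK; rewrite /w addr0.
Qed.

(* Since R(N) <= 0, the integer 2 - R(N) is positive and [absz] is exact. *)
Theorem theorem4p4 (R : realType) (N : nat) (hN : (3 < N)%N) :
  Totnu R N = TotFIB (fib (absz (- Rindex R N + 2)%R) * N)%N.
Proof.
have N0 : (0 < N)%N by lia.
have small := RindexP R N0; have bN := betaP R N.
have r0 := smallest_index_le0 bN.1 small.
have [k rk] : exists k, absz (- Rindex R N + 2)%R = k.+1.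
  by exists (absz (- Rindex R N + 2)%R).-1; lia.
have hk : k.+1%:Z = 2 - Rindex R N by lia.
rewrite /Totnu /TotFIB rk.
apply: (@count_set_bij _ _ _ _ (to_fib (Rindex R N)) (of_fib (Rindex R N))).
- by move=> a [[ha _] [_ ra]]; exact: to_fib_expansion ha.
- by move=> c; exact: (of_fib_natural hk bN small).
- by move=> a [_ [_ ra]]; exact: to_fibK.
- by move=> c [c2 _]; exact: of_fibK.
Qed.
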